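(* For every prime $p$ and every quadratic irrational $\alpha\in\mathbb{R}$ (i.e. a real root of an irreducible quadratic polynomial over $\mathbb{Q}$), \[\liminf_{n\to\infty,\ n\in\mathbb{N}} \; n\,|n|_p\,\|n\alpha\|\,\log n<\infty.\]
   Context: For a real number $x$, $\|x\|$ denotes the distance from $x$ to the nearest integer. For a prime $p$ and an integer $n$, the $p$-adic absolute value $|n|_p$ is $0$ if $n=0$ and $p^{-\ell}$ if $n=p^{\ell}m$ with $m$ a nonzero integer coprime to $p$. *)

(* Defs.v *)
From mathcomp Require Import all_boot all_order all_algebra.
From mathcomp Require Import boolp classical_sets reals.

Set Implicit Arguments.
Unset Strict Implicit.
Unset Printing Implicit Defensive.

Import Order.TTheory GRing.Theory Num.Theory.

Local Open Scope classical_set_scope.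
Local Open Scope ring_scope.

Definition dist_int (R : realType) (x : R) : R :=
  inf [set `|x - m%:~R| | m in [set: int]].

(* The case split is needed because [logn p 0 = 0]. *)
Definition padic_abs (R : realType) (p : nat) (n : int) : R :=
  if n == 0 then 0 else p%:R ^- logn p `|n|%N.

Definition quadratic_irrational (R : realType) (alpha : R) : Prop :=
  exists f : {poly rat},
    [/\ size f = 3%N, irreducible_poly f & root (map_poly ratr f) alpha].

(* Main.v *)
(** Write [q alpha = b +- s] with [s > 0] and [s ^ 2 = D] an integer divisible by
    [p].  A nontrivial solution of [u ^ 2 - D v ^ 2 = 1] gives a unit
    [eps = u + v s > 1] with inverse [u - v s], and since [p] divides [D], [p ^ k]
    divides the coefficient [Y] in [eps ^ (p ^ k) = X + Y s].  For [n = q Y] one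
    has [n = O(eps ^ (p ^ k))], [||n alpha|| <= |X - Y s| = eps ^ (- p ^ k)],
    [|n|_p <= p ^ (- k)] and [log n = O(p ^ k)], so the product stays bounded. *)

Require Import Defs.
From mathcomp Require Import all_boot all_order all_algebra.
From mathcomp Require Import boolp classical_sets reals ereal topology.
From mathcomp Require Import normedtype sequences exp.
From mathcomp Require Import ring lra zify.

Import Order.TTheory GRing.Theory Num.Theory.

Local Open Scope ring_scope.

(** * Lower limits, distance to the integers, p-adic size *)

Lemma limn_einf_le_frequently (R : realType) (u : (\bar R)^nat) (C : \bar R) :
  (forall m : nat, exists2 n : nat, (m <= n)%N & (u n <= C)%E) ->
  (limn_einf u <= C)%E.
Proof.
move=> uC; rewrite limn_einf_lim; apply: lime_le; first exact: is_cvg_einfs.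
apply: filterE => m; have [n mn unC] := uC m.
by apply: ge_ereal_inf; exists (u n) => //; exists n.
Qed.

Lemma dist_int_ge0 (R : realType) (x : R) : 0 <= dist_int x.
Proof. by apply: lb_le_inf => [|_ [m _ <-]//]; exists `|x - 0%:~R|, 0. Qed.

Lemma dist_int_le (R : realType) (x : R) (m : int) : dist_int x <= `|x - m%:~R|.
Proof. by apply: ge_inf; [exists 0 => _ [k _ <-] | exists m]. Qed.

Lemma padic_abs_le (R : realType) (p k n : nat) :
  prime p -> (0 < n)%N -> (p ^ k %| n)%N -> padic_abs R p n%:Z <= p%:R ^- k.
Proof.
move=> pp n0 pkn; rewrite /padic_abs eqz_nat (gtn_eqF n0) /=.
have p1 : 1 <= p%:R :> R by rewrite ler1n prime_gt0.
have p0 : 0 < p%:R :> R by rewrite ltr0n prime_gt0.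
by rewrite lef_pV2 ?posrE ?exprn_gt0 // ler_weXn2l // -pfactor_dvdn.
Qed.

(** * Dirichlet approximation *)

(* Pigeonhole on the fractional parts of [y * s] for [0 <= y <= N]. *)
Lemma dirichlet_approximation (R : realType) (s : R) (N : nat) : (0 < N)%N ->
  exists x : int, exists y : nat,
    [/\ (0 < y)%N, (y <= N)%N & N%:R * `|x%:~R - y%:R * s| < 1].
Proof.
case: N => // N _.
pose r (y : nat) : R := y%:R * s - (Num.floor (y%:R * s))%:~R.
have r01 y : 0 <= r y < 1.
  by have := floor_itv (y%:R * s); rewrite intrD /r; lra.
pose t (y : nat) : R := N.+1%:R * r y.
have N0 : 0 < N.+1%:R :> R by [].
have t_itv y : 0 <= Num.floor (t y) < N.+1%:Z.
  have /andP[r0 r1] := r01 y; rewrite floor_ge0 floor_lt_int mulr_ge0 //=.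
  by rewrite -[ltRHS]mulr1 ltr_pM2l.
(* The [N.+2] values of [y] fall into [N.+1] boxes of length [1 / N.+1], so two fractional parts
   share a box. *)
pose f (y : 'I_N.+2) : 'I_N.+1 := inord `|Num.floor (t y)|.
have /injectivePn[y1 [y2 y12 fy12]] : ~~ injectiveb f.
  apply/negP => /injectiveP /leq_card; by rewrite !card_ord ltnn.
have {fy12} fl : Num.floor (t y1) = Num.floor (t y2).
  move/(congr1 val): fy12; rewrite /= !inordK; first by have := t_itv y1; have := t_itv y2; lia.
  - by have := t_itv y2; lia.
  - by have := t_itv y1; lia.
wlog lt12 : y1 y2 y12 fl / (y1 < y2)%N.
  move=> H; case: (ltngtP y1 y2) => [||/val_inj e]; first exact: H.
  - by apply: H => //; rewrite eq_sym.
  - by rewrite e eqxx in y12.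
exists (Num.floor (y2%:R * s) - Num.floor (y1%:R * s)), (y2 - y1)%N.
split; [by rewrite subn_gt0|by have := ltn_ord y2; lia|].
have := floor_itv (t y1); have := floor_itv (t y2); rewrite fl.
rewrite -{1}(ger0_norm (ltW N0)) -normrM natrB ?(ltnW lt12)// /t /r !intrD intrN.
move: (Num.floor (t y2)) => z.
by move=> H1 H2; rewrite ltr_norml; apply/andP; split; lra.
Qed.

(** * Powers of quadratic units and divisibility by powers of p *)

(* Quantifying over all square roots [s] of [D] also covers the conjugate. *)
Lemma quadratic_power (p D x y : int) (n : nat) : (p %| D)%Z ->
  exists X Y : int,
    [/\ forall (R : comPzRingType) (s : R), s ^+ 2 = D%:~R ->
          X%:~R + Y%:~R * s = (x%:~R + y%:~R * s) ^+ n.+1,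
        (p %| X - x ^+ n.+1)%Z & (p * y %| Y - n.+1%:Z * (x ^+ n * y))%Z].
Proof.
move=> /dvdzP[E ->]; elim: n => [|n [X [Y [XY /dvdzP[a Xa] /dvdzP[b Yb]]]]].
  by exists x, y; split; rewrite ?expr1 ?subrr ?dvdz0 // expr0 !mul1r subrr dvdz0.
(* Coefficients of [(x + y s) (X + Y s)] with [s ^ 2 = E p]; modulo [p] the first is just [x X]. *)
exists (x * X + E * p * y * Y), (x * Y + y * X); split.
- move=> R s s2; rewrite exprS -(XY R s s2) !(intrD, intrM).
  rewrite intrM in s2.
  transitivity ((x%:~R * X%:~R + s ^+ 2 * y%:~R * Y%:~R
     + (x%:~R * Y%:~R + y%:~R * X%:~R) * s) : R); first by rewrite s2.
  by ring.
- apply/dvdzP; exists (x * a + E * y * Y).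
  have -> : X = a * p + x ^+ n.+1 by rewrite -Xa; ring.
  by rewrite [in RHS]mulrDl !exprS; ring.
- apply/dvdzP; exists (x * b + a).
  have -> : X = a * p + x ^+ n.+1 by rewrite -Xa; ring.
  have -> : Y = b * (p * y) + n.+1%:Z * (x ^+ n * y) by rewrite -Yb; ring.
  by rewrite !exprS -[n.+2]addn1 PoszD; ring.
Qed.

(** A [p]-th power turns [Y] into [Y'] congruent to [p X ^ (p - 1) Y] modulo [p Y], which gains one
    factor [p]. *)
Lemma unit_power_dvd (p : nat) (D u v : int) (k : nat) :
  (0 < p)%N -> (p%:Z %| D)%Z ->
  exists X Y : int, (p%:Z ^+ k %| Y)%Z /\
    forall (R : comPzRingType) (s : R), s ^+ 2 = D%:~R ->
      X%:~R + Y%:~R * s = (u%:~R + v%:~R * s) ^+ (p ^ k).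
Proof.
move=> p0 pD; elim: k => [|k [X [Y [pY XY]]]].
  by exists u, v; split=> *; rewrite ?expr0 ?dvd1z ?expn0 ?expr1.
have [X' [Y' [XY' _ dY']]] := @quadratic_power p%:Z D X Y p.-1 pD.
rewrite prednK // in XY' dY'.
exists X', Y'; split => [|R s s2]; last by rewrite XY' // XY // -exprM expnSr.
have pYY' : (p%:Z * Y %| Y')%Z.
  move: dY' => /dvdzP[a aE]; apply/dvdzP; exists (a + X ^+ p.-1).
  by rewrite mulrDl -aE; ring.
by apply: dvdz_trans pYY'; rewrite exprS dvdz_mul.
Qed.

(** * Elements of small norm and Pell's equation *)

Lemma quadratic_norm (R : comPzRingType) (D x y : int) (s : R) :
  s ^+ 2 = D%:~R -> (x ^+ 2 - D * y ^+ 2)%:~R =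
   (x%:~R + y%:~R * s) * (x%:~R - y%:~R * s) :> R.
Proof. by move=> s2; rewrite !expr2 intrD intrN !intrM -s2; ring. Qed.

(** If [|x - y s| < 1 / N] and [0 < y <= N], the conjugate has size at most [|x - y s| + 2 N s], so
    the norm is bounded independently of [N]. *)
Lemma exists_small_norm (R : realType) (D : int) (s d : R) :
  0 < s -> s ^+ 2 = D%:~R -> (forall x y : int, x%:~R = y%:~R * s -> y = 0) ->
  0 < d ->
  exists x y : int, [/\ 0 < `|x%:~R - y%:~R * s|, `|x%:~R - y%:~R * s| < d
    & `|(x ^+ 2 - D * y ^+ 2)%:~R| <= 1 + 2 * s].
Proof.
move=> s0 s2 irr d0; pose N := (Num.bound d^-1).+1.
have N0 : 0 < N%:R :> R by [].
have dN : 1 < N%:R * d.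
  by rewrite -ltr_pdivrMr // mul1r (lt_trans (archi_boundP _)) ?invr_ge0 ?ltW // ltr_nat.
have [x [y [y0 yN xyN]]] := dirichlet_approximation R s _ (ltn0Sn (Num.bound d^-1)).
rewrite -/N in xyN; exists x, y%:Z; rewrite -pmulrn; split.
- rewrite normr_gt0 subr_eq0; apply/eqP => E; have := irr x y%:Z E; lia.
- by rewrite -(ltr_pM2l N0); apply: lt_trans dN.
have -> : (x ^+ 2 - D * y%:Z ^+ 2)%:~R =
    (x%:~R - y%:R * s) * (x%:~R - y%:R * s + 2 * y%:R * s) :> R.
  by rewrite (quadratic_norm R D x y%:Z s s2) -pmulrn; ring.
have N1 : 1 <= N%:R :> R by rewrite ler1n.
have yNR : y%:R <= N%:R :> R by rewrite ler_nat.
have y0R : 0 <= y%:R :> R by [].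
rewrite normrM; move: xyN; move: (x%:~R - y%:R * s) => e eN.
have e0 : 0 <= `|e| by [].
have : `|e + 2 * y%:R * s| <= `|e| + 2 * N%:R * s.
  by rewrite (le_trans (ler_normD _ _)) // lerD2l ger0_norm; nra.
have -> : 1 + 2 * s = 1 * (1 + 2 * s) by rewrite mul1r.
move=> H; apply: (le_trans (ler_wpM2l e0 H)).
have : `|e| <= 1 by nra.
by nra.
Qed.

Lemma pigeonhole_mod (K L : nat) (n x y : nat -> int) :
  (0 < L)%N -> (forall i, (`|n i| <= K)%N) ->
  exists i j, [/\ (i < j)%N, n i = n j, (L%:Z %| x i - x j)%Z
    & (L%:Z %| y i - y j)%Z].
Proof.
move=> L0 nK.
have mod_itv (a : int) : (`|(a %% L%:Z)%Z| < L.+1)%N.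
  have : 0 <= (a %% L%:Z)%Z by rewrite modz_ge0; lia.
  have := @ltz_mod a L%:Z; lia.
have inord_inj m (a b : nat) : (a < m.+1)%N -> (b < m.+1)%N ->
    inord a = inord b :> 'I_m.+1 -> a = b.
  by move=> am bm /(congr1 val) /=; rewrite !inordK.
have mod_inj (a b : int) :
    inord `|(a %% L%:Z)%Z| = inord `|(b %% L%:Z)%Z| :> 'I_L.+1 ->
    (L%:Z %| a - b)%Z.
  move=> /inord_inj -/(_ (mod_itv _) (mod_itv _)) ab; rewrite -eqz_mod_dvd.
  have : 0 <= (a %% L%:Z)%Z by rewrite modz_ge0; lia.
  have : 0 <= (b %% L%:Z)%Z by rewrite modz_ge0; lia.
  by move: ab => /=; lia.
have shift_itv (a : int) : (`|a| <= K)%N -> (`|(a + K%:Z)%R| < (2 * K).+1)%N by lia.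
have shift_inj (a b : int) : (`|a| <= K)%N -> (`|b| <= K)%N ->
    inord `|(a + K%:Z)%R| = inord `|(b + K%:Z)%R| :> 'I_(2 * K).+1 -> a = b.
  by move=> aK bK /inord_inj -/(_ (shift_itv _ aK) (shift_itv _ bK)); lia.
pose T : finType := ('I_(2 * K).+1 * 'I_L.+1 * 'I_L.+1)%type.
(* The key records [n i], shifted by [K] into [[0, 2 K]], and both residues; [#|T|.+1] indices force
   a collision. *)
pose key (i : 'I_#|T|.+1) : T :=
  (inord `|n i + K%:Z|, inord `|(x i %% L%:Z)%Z|, inord `|(y i %% L%:Z)%Z|).
have /injectivePn[i [j ij [kn kx ky]]] : ~~ injectiveb key.
  by apply/negP => /injectiveP /leq_card; rewrite card_ord ltnn.
have {}kn := shift_inj _ _ (nK i) (nK j) kn.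
have {}kx := mod_inj _ _ kx; have {}ky := mod_inj _ _ ky.
case: (ltngtP i j) => [ltij|ltji|/val_inj E].
- by exists i, j.
- by exists j, i; split=> //; rewrite -opprB rpredN.
- by rewrite E eqxx in ij.
Qed.

(** With [s ^ 2 = D], [u + v s] is the quotient of [x1 + y1 s] by [x2 + y2 s], that is
    [(x1 + y1 s) (x2 - y2 s) / n]. The congruences make it integral, and equal norms give it norm
    1. *)
Lemma congruent_quotient (D x1 y1 x2 y2 : int) (n := x1 ^+ 2 - D * y1 ^+ 2) :
  n != 0 -> x2 ^+ 2 - D * y2 ^+ 2 = n ->
  (n %| x1 - x2)%Z -> (n %| y1 - y2)%Z ->
  exists u v : int, [/\ u ^+ 2 - D * v ^+ 2 = 1,
    x1 * x2 - D * y1 * y2 = u * n & x2 * y1 - x1 * y2 = v * n].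
Proof.
move=> n0 n2 /dvdzP[a Ea] /dvdzP[b Eb].
pose u := 1 - x1 * a + D * y1 * b; pose v := x1 * b - y1 * a.
have Eu : x1 * x2 - D * y1 * y2 = u * n.
  transitivity (n - x1 * (a * n) + D * y1 * (b * n)); last by rewrite /u; ring.
  by rewrite -Ea -Eb /n; ring.
have Ev : x2 * y1 - x1 * y2 = v * n.
  transitivity (x1 * (b * n) - y1 * (a * n)); last by rewrite /v; ring.
  by rewrite -Ea -Eb; ring.
exists u, v; split=> //; apply: (mulfI (expf_neq0 2 n0)); rewrite mulr1.
transitivity ((u * n) ^+ 2 - D * (v * n) ^+ 2); first by ring.
rewrite -Eu -Ev.
transitivity (n * (x2 ^+ 2 - D * y2 ^+ 2)); first by rewrite /n; ring.
by rewrite n2 expr2.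
Qed.

Lemma quadratic_conj_neq0 (R : realType) (D x y : int) (s : R) :
  (forall x y : int, x%:~R = y%:~R * s -> y = 0) ->
  x%:~R - y%:~R * s != 0 -> x%:~R + y%:~R * s != 0.
Proof.
move=> irr; apply: contra_neq => E.
have /irr y0 : x%:~R = (- y)%:~R * s by rewrite rmorphN /=; lra.
have {}y0 : y = 0 by lia.
by move: E; rewrite y0 !mul0r addr0 subr0.
Qed.

(** Absolute values pick the largest of [+-u +- v s]; [u] is nonzero because [- D v ^ 2 <= 0]. *)
Lemma pell_abs (R : realType) (D u v : int) (s : R) :
  0 < s -> s ^+ 2 = D%:~R -> v != 0 -> u ^+ 2 - D * v ^+ 2 = 1 ->
  1 < `|u|%:~R + `|v|%:~R * s.
Proof.
move=> s0 s2 v0 uv.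
have u0 : u != 0.
  apply/eqP => u0; move: uv; rewrite u0 expr0n /= sub0r => uv.
  have : (D * v ^+ 2)%:~R >= 0 :> R.
    by rewrite expr2 !intrM -s2 mulr_ge0 ?sqr_ge0 // -expr2 sqr_ge0.
  by rewrite ler0z; lia.
have u1 : 1 <= `|u|%:~R :> R by rewrite ler1z; lia.
have v1 : 1 <= `|v|%:~R :> R by rewrite ler1z; lia.
nra.
Qed.

(* Infinitely many elements [x - y s] have bounded norm; two of them share
   their norm [n] and their residues modulo [n], and their quotient is a unit. *)
Lemma pell_solution (R : realType) (D : int) (s : R) :
  0 < s -> s ^+ 2 = D%:~R -> (forall x y : int, x%:~R = y%:~R * s -> y = 0) ->
  exists u v : int, 1 < u%:~R + v%:~R * s /\ u ^+ 2 - D * v ^+ 2 = 1.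
Proof.
move=> s0 s2 irr.
pose e (z : int * int) : R := `|z.1%:~R - z.2%:~R * s|.
pose norm (z : int * int) : int := z.1 ^+ 2 - D * z.2 ^+ 2.
have [K KP] : exists K : nat, 1 + 2 * s < K%:R.
  by exists (Num.bound (1 + 2 * s)); apply: archi_boundP; lra.
have small d : 0 < d -> exists z, [/\ 0 < e z, e z < d & (`|norm z| <= K)%N].
  move=> d0; have [x [y [e0 ed le]]] := exists_small_norm R D s d s0 s2 irr d0.
  exists (x, y); split=> //.
  have := le_lt_trans le KP.
  by rewrite -intr_norm pmulrn ltr_int /norm /=; lia.
(* The guard [0 < e z] makes the successor total, as [choice] requires; iterating it makes [e]
   positive and strictly decreasing. *)
have next z : exists z', 0 < e z -> [/\ 0 < e z', e z' < e z & (`|norm z'| <= K)%N].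
  have [/small[z' ?]|] := ltP 0 (e z); [by exists z' | by exists z].
have [g gP] := choice next.
have [z0 [z00 _ z0K]] := small _ ltr01.
pose z i := iter i g z0.
have zP i : 0 < e (z i) /\ (`|norm (z i)| <= K)%N.
  by elim: i => [//|i [/gP[]]].
have e_decr i j : (i < j)%N -> e (z j) < e (z i).
  elim: j => // j IH; rewrite ltnS leq_eqVlt => ij.
  have [/gP[_ lt _] _] := zP j.
  by case/predU1P: ij => [->//|/IH]; apply: lt_trans.
(* The norms are nonzero of size at most [K], so each divides [K!], a modulus fixed before the
   common norm is known. *)
have [i [j [/e_decr ltij nij dx dy]]] := pigeonhole_mod K K`!
  (fun i => norm (z i)) (fun i => (z i).1) (fun i => (z i).2)
  (fact_gt0 K) (fun i => (zP i).2).
have [ei0 iK] := zP i.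
move: (z i) (z j) ei0 iK ltij nij dx dy => [x1 y1] [x2 y2].
rewrite /e /norm /= normr_gt0 => {e norm z small next g gP z0 z00 z0K zP e_decr KP}.
move=> ei0 iK ltij nij dx dy.
have conj0 := quadratic_conj_neq0 R D x1 y1 s irr ei0.
have nE := quadratic_norm R D x1 y1 s s2.
have n0 : x1 ^+ 2 - D * y1 ^+ 2 != 0 by rewrite -(intr_eq0 R) nE mulf_neq0.
have nK : (x1 ^+ 2 - D * y1 ^+ 2 %| (K`!)%:Z)%Z.
  by rewrite dvdzE; apply: dvdn_fact; rewrite absz_gt0 n0.
have [u [v [uv Eu Ev]]] := congruent_quotient D x1 y1 x2 y2 n0 (esym nij)
  (dvdz_trans nK dx) (dvdz_trans nK dy).
(* If [v = 0] then [u] is 1 or -1, so both elements have equal size, against the strict decrease of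
   [e]. *)
suff v0 : v != 0.
  by exists `|u|, `|v|; rewrite !real_normK ?num_real //; split=> //; exact: (pell_abs R D).
apply/eqP => v0; move: uv Ev Eu; rewrite v0 expr0n mulr0 subr0 mul0r => u2 Ev Eu.
move: ltij; rewrite ltNge => /negP; apply.
suff <- : u%:~R * (x1%:~R - y1%:~R * s) = x2%:~R - y2%:~R * s.
  have -> : `|u%:~R * (x1%:~R - y1%:~R * s)| = `|u|%:~R * `|x1%:~R - y1%:~R * s|.
    by rewrite normrM intr_norm.
  have -> : `|u| = 1 by apply/eqP; rewrite -(@pexpr_eq1 _ _ 2) // -normrX u2 normr1.
  by rewrite mul1r.
(* After multiplication by [x1 + y1 s], the sides differ by a multiple of
   [x2 y1 - x1 y2 = v n = 0]. *)
apply: (mulfI conj0); rewrite mulrCA -nE -intrM -Eu.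
have /(congr1 (fun k : int => k%:~R * s)) := Ev.
rewrite !(intrD, intrN, intrM) mul0r -s2 => EvR.
apply/eqP; rewrite -subr_eq0; apply/eqP.
transitivity (- ((x2%:~R * y1%:~R - x1%:~R * y2%:~R) * s)); first by ring.
by rewrite EvR oppr0.
Qed.

(** * Reduction of a quadratic irrational to a square root *)

(** Clearing denominators gives integer coefficients; a rational [alpha] would give the irreducible
    quadratic [f] a linear factor. *)
Lemma quadratic_irrational_coef (R : realType) (alpha : R) :
  quadratic_irrational alpha ->
  exists a b c : int,
    [/\ a != 0, a%:~R * alpha ^+ 2 + b%:~R * alpha + c%:~R = 0
      & forall x y : int, y%:~R * alpha = x%:~R -> y = 0].
Proof.
case=> f [f3 irrf rootf].
have [q [d d0 fE]] := rat_poly_scale f.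
have d0R : d%:~R^-1 != 0 :> rat by rewrite invr_eq0 intr_eq0.
have size_q : size q = 3%N.
  by rewrite -f3 fE size_scale // size_map_inj_poly //; exact: intr_inj.
exists q`_2, q`_1, q`_0; split.
- by have := lead_coef_eq0 q; rewrite lead_coefE size_q /= => ->; rewrite -size_poly_eq0 size_q.
- move: rootf; rewrite fE map_polyZ rootZ ?fmorph_eq0 // -map_poly_comp.
  rewrite (eq_map_poly (g := intr)); last by move=> z /=; rewrite ratr_int.
  rewrite /root (horner_coef_wide (n := 3)) ?size_map_inj_poly ?size_q //; last exact: intr_inj.
  rewrite !big_ord_recl big_ord0 !coef_map_id0 //= => /eqP <-.
  by rewrite expr0 expr1; ring.
- move=> x y xy; apply/eqP/negPn/negP => y0.
  have y0R : y%:~R != 0 :> R by rewrite intr_eq0.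
  have aE : alpha = ratr (x%:~R / y%:~R).
    by rewrite fmorph_div /= !ratr_int -xy mulrC mulKf.
  move: rootf; rewrite aE fmorph_root -dvdp_XsubCl => /irrf.2.
  by rewrite size_XsubC => /(_ isT) /eqp_size; rewrite size_XsubC f3.
Qed.

(* Scaling the discriminant by [p ^ 2] makes it divisible by [p], as needed to
   start the induction on the power of [p] dividing [Y]. *)
Lemma quadratic_irrational_sqrt (R : realType) (p : nat) (alpha : R) :
  (0 < p)%N -> quadratic_irrational alpha ->
  exists (q : nat) (b t D : int) (s : R),
    [/\ (0 < q)%N /\ `|t| = 1, 0 < s /\ s ^+ 2 = D%:~R, (p%:Z %| D)%Z,
      forall x y : int, x%:~R = y%:~R * s -> y = 0
      & q%:R * alpha = b%:~R + t%:~R * s].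
Proof.
move=> p0 /quadratic_irrational_coef[a0 [b0 [c0 [a00 eq0 irr]]]].
(* Changing all signs if necessary makes [2 a alpha + b] positive; it is nonzero as [alpha] is
   irrational. *)
have [a [b [c [an0 eqa t0]]]] : exists a b c : int, [/\ a != 0,
    a%:~R * alpha ^+ 2 + b%:~R * alpha + c%:~R = 0
    & 0 < 2 * a%:~R * alpha + b%:~R].
  have [t0|t0|t0] := ltgtP 0 (2 * a0%:~R * alpha + b0%:~R).
  - by exists a0, b0, c0.
  - exists (- a0), (- b0), (- c0); rewrite oppr_eq0 !intrN; split=> //; last by lra.
    by rewrite -[RHS]oppr0 -eq0; ring.
  - have /irr : (2 * a0)%:~R * alpha = (- b0)%:~R by rewrite intrM intrN; lra.
    by lia.
have pR : 0 < p%:R :> R by rewrite ltr0n.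
(* With [s = p (2 a alpha + b)], [2 a p alpha = s - p b]; multiplying by the sign of [a] makes [q]
   positive. *)
exists (2 * `|a| * p)%N, (- (sgz a * p%:Z * b)), (sgz a),
  (p%:Z ^+ 2 * (b ^+ 2 - 4 * a * c)), (p%:R * (2 * a%:~R * alpha + b%:~R)).
split.
- by split; [rewrite !muln_gt0 absz_gt0 an0 | apply/eqP; rewrite normr_sgz an0].
- split; first exact: mulr_gt0.
  rewrite !expr2 !(intrD, intrN, intrM) -!pmulrn.
  have -> : c%:~R = - (a%:~R * alpha ^+ 2 + b%:~R * alpha) by lra.
  by ring.
- by rewrite expr2 -mulrA dvdz_mulr.
- move=> x y xy.
  have : (2 * a * p%:Z * y)%:~R * alpha = (x - y * p%:Z * b)%:~R.
    by rewrite intrD intrN !intrM xy -!pmulrn; ring.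
  move=> /irr /eqP; rewrite !mulf_eq0 (negPf an0) /= => /eqP; lia.
- have aE : `|a|%N%:R = (sgz a * a)%:~R :> R by rewrite -abszEsg -pmulrn.
  by rewrite !natrM aE !(intrN, intrM) -pmulrn; ring.
Qed.

(** * The bounded subsequence *)

Lemma ln_le_id (R : realType) (x : R) : 0 < x -> ln x <= x.
Proof.
move=> x0; have x1 : -1 < x - 1 by lra.
by have := le_ln1Dx x1; rewrite addrC subrK; lra.
Qed.

Lemma frequently_bounded (R : realType) (p : nat) (alpha : R) :
  prime p -> quadratic_irrational alpha ->
  exists C : R, forall k : nat, exists2 n : nat, (k <= n)%N &
    n%:R * padic_abs R p n%:Z * dist_int (n%:R * alpha) * ln (n%:R : R) <= C.
Proof.
move=> pp qa; have p0 := prime_gt0 pp.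
have [q [b [t [D [s [[q0 t1] [s0 s2] pD irr alphaE]]]]]] :=
  quadratic_irrational_sqrt R p alpha p0 qa.
have [u [v [eps1 uv]]] := pell_solution R D s s0 s2 irr.
set eps := u%:~R + v%:~R * s in eps1.
have epsV : u%:~R - v%:~R * s = eps^-1.
  have eps0 : eps != 0 by rewrite gt_eqF //; lra.
  apply: (mulfI eps0); rewrite divff // -(quadratic_norm R D u v s s2) uv //.
pose A := q%:R / (2 * s); pose L := ln eps.
have qR : 0 < q%:R :> R by rewrite ltr0n.
have A0 : 0 < A by rewrite divr_gt0 //; lra.
have L0 : 0 <= L by rewrite ln_ge0 // ltW.
(* Product of the bounds [A eps ^ N], [1 / N], [eps ^ (- N)] and [N (A + L)] on the four factors,
   where [N = p ^ k]. *)
exists (A * (A + L)) => k.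
have [X [Y [pY XY]]] := unit_power_dvd p D u v k p0 pD.
pose N := (p ^ k)%N.
have N0 : (0 < N)%N by rewrite expn_gt0 p0.
have XpY : X%:~R + Y%:~R * s = eps ^+ N by exact: XY.
(* [- s] is also a square root of [D], so the same [X] and [Y] serve the conjugate. *)
have XmY : X%:~R - Y%:~R * s = eps ^- N.
  rewrite -mulrN XY ?sqrrN // mulrN epsV exprVn //.
have epsN1 : 1 < eps ^+ N by rewrite exprn_egt1 // -lt0n.
have epsN0 : 0 < eps ^+ N by lra.
have epsNV : 0 < eps ^- N < 1 by rewrite invr_gt0 epsN0 invf_lt1.
have Y2 : 2 * s * Y%:~R = eps ^+ N - eps ^- N by rewrite -XmY -XpY; ring.
have Y0 : 0 < Y.
  rewrite -(ltr0z R) -(pmulr_rgt0 _ (_ : 0 < 2 * s)) ?Y2; last by lra.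
  by lra.
pose n := (q * `|Y|)%N.
have nR : n%:R = q%:R * Y%:~R :> R.
  by rewrite natrM natr_absz gtr0_norm.
have n0 : (0 < n)%N by rewrite muln_gt0 q0 absz_gt0 gt_eqF.
have pn : (p ^ k %| n)%N.
  by move: pY; rewrite dvdzE abszX /= => pY; exact: dvdn_mull.
exists n.
  by apply: leq_trans (dvdn_leq n0 pn); rewrite ltnW // ltn_expl // prime_gt1.
have n_le : n%:R <= A * eps ^+ N.
  rewrite nR /A -mulrA ler_pM2l // ler_pdivlMl; last by lra.
  by rewrite Y2; lra.
have dist_le : dist_int (n%:R * alpha) <= eps ^- N.
  (* As [n alpha = Y b + t Y s], this integer is at distance [|X - Y s|]. *)
  apply: le_trans (dist_int_le R _ (Y * b + t * X)) _.
  rewrite nR -mulrA mulrCA alphaE intrD !intrM -XmY.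
  rewrite (_ : _ - _ = - (t%:~R * (X%:~R - Y%:~R * s))); last by ring.
  rewrite normrN normrM -intr_norm t1 mul1r XmY gtr0_norm //; lra.
have ln_le : ln n%:R <= N%:R * (A + L).
  have nR0 : 0 < n%:R :> R by rewrite ltr0n.
  have : ln n%:R <= ln (A * eps ^+ N) by rewrite ler_ln ?posrE // mulr_gt0.
  rewrite lnM ?posrE // lnXn; last by lra.
  rewrite -mulr_natl -/L => H; apply: (le_trans H).
  (* [ln A <= A], and [1 <= N] gives [A <= N A]. *)
  have := ln_le_id R A A0; have : 1 <= N%:R :> R by rewrite ler1n.
  by nra.
have pad_le := padic_abs_le R p k n pp n0 pn.
have ln0 : 0 <= ln n%:R :> R by rewrite ln_ge0 // ler1n.
have pad0 : 0 <= padic_abs R p n%:Z.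
  by rewrite /padic_abs; case: ifP => // _; rewrite invr_ge0 exprn_ge0.
have dist0 := dist_int_ge0 R (n%:R * alpha).
have -> : A * (A + L) = A * eps ^+ N * p%:R ^- k * eps ^- N * (N%:R * (A + L)).
  by rewrite natrX; field; rewrite gt_eqF //= expf_neq0 // pnatr_eq0 -lt0n.
by rewrite !ler_pM // ?mulr_ge0.
Qed.

Theorem theorem1 (R : realType) (p : nat) (alpha : R) :
  prime p -> quadratic_irrational alpha ->
  (limn_einf (fun n : nat =>
     (n%:R * padic_abs R p n%:Z * dist_int (n%:R * alpha) * ln (n%:R : R))%:E)
   < +oo)%E.
Proof.
move=> pp qa; have [C HC] := frequently_bounded R p alpha pp qa.
apply: (@le_lt_trans _ _ C%:E); last exact: ltry.
apply: limn_einf_le_frequently => m; have [n mn nC] := HC m.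
by exists n; rewrite ?lee_fin.
Qed.
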